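(* Fix $l=2m+1$ with $m>0$ and an integer $r$ prime to $l$. Let $u,v\in\mathbb{Z}/2[x_1,\dots,x_m]$ and let $N$ be the ideal of this ring generated by the elements $R_{i,j}$, $m\ge i>j\ge 1$. Suppose that the ideals $(N,v)$ and $(N,u,v)$ are equal, and that $\phi_r(v)\neq 0$. Then the element $\phi_r(u)/\phi_r(v)$ of the field of fractions of $S$ in fact lies in $S$.
   Context: For an integer $i$, $[i]=\sum x^{n^2}\in\mathbb{Z}/2[[x]]$, summed over $n\in\mathbb{Z}$ with $n\equiv i\pmod l$; $S$ is the subring of $\mathbb{Z}/2[[x]]$ generated over $\mathbb{Z}/2$ by $[1],\dots,[m]$. For $r$ prime to $l$, $\phi_r:\mathbb{Z}/2[x_1,\dots,x_m]\to S$ is the ring homomorphism with $x_k\mapsto[rk]$. For $1\le k\le m$ set $x_{l-k}:=x_k$, and for $m\ge i>j\ge 1$ let $R_{i,j}=x_i^4x_{2j}+x_j^4x_{2i}+x_{2i}x_{2j}+x_{i+j}^2x_{i-j}^2$. *)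

(* Defs.v *)
From HB Require Import structures.
From mathcomp Require Import all_boot all_order all_algebra fraction.
From mathcomp Require Import boolp.
From mathcomp Require Import mpoly.
From mathcomp Require Import zify.
Set Implicit Arguments.
Unset Strict Implicit.
Unset Printing Implicit Defensive.
Import GRing.Theory.
Local Open Scope ring_scope.

Record fps (R : Type) := Fps { fpscoef : nat -> R }.

HB.instance Definition _ (R : Type) := gen_eqMixin (fps R).
HB.instance Definition _ (R : Type) := gen_choiceMixin (fps R).

Lemma fpsP (R : Type) (f g : fps R) :
  (forall n, fpscoef f n = fpscoef g n) -> f = g.
Proof. by case: f g => [f] [g] /= e; congr Fps; apply: funext. Qed.

Section FpsZmod.
Variable R : zmodType.
Definition fps0 : fps R := Fps (fun=> 0).
Definition fpsopp (f : fps R) := Fps (fun n => - fpscoef f n).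
Definition fpsadd (f g : fps R) := Fps (fun n => fpscoef f n + fpscoef g n).
Fact fpsaddA : associative fpsadd.
Proof. by move=> f g h; apply: fpsP => n /=; rewrite addrA. Qed.
Fact fpsaddC : commutative fpsadd.
Proof. by move=> f g; apply: fpsP => n /=; rewrite addrC. Qed.
Fact fpsadd0 : left_id fps0 fpsadd.
Proof. by move=> f; apply: fpsP => n /=; rewrite add0r. Qed.
Fact fpsaddN : left_inverse fps0 fpsopp fpsadd.
Proof. by move=> f; apply: fpsP => n /=; rewrite addNr. Qed.
HB.instance Definition _ :=
  GRing.isZmodule.Build (fps R) fpsaddA fpsaddC fpsadd0 fpsaddN.
End FpsZmod.

Section FpsRing.
Variable R : comNzRingType.
Implicit Types f g h : fps R.

Definition fps1 : fps R := Fps (fun n => (n == 0)%N%:R).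
Definition fpsmul f g : fps R :=
  Fps (fun n => \sum_(i < n.+1) fpscoef f i * fpscoef g (n - i)).

Definition fpstrunc N f : {poly R} := \poly_(i < N.+1) fpscoef f i.

Lemma coef_fpstrunc N f n : (n <= N)%N -> (fpstrunc N f)`_n = fpscoef f n.
Proof. by rewrite coef_poly ltnS => ->. Qed.

Lemma fpsmulE N n f g : (n <= N)%N ->
  fpscoef (fpsmul f g) n = (fpstrunc N f * fpstrunc N g)`_n.
Proof.
move=> le_nN; rewrite coefM; apply: eq_bigr => i _.
have le_in : (i <= n)%N by rewrite -ltnS.
by rewrite !coef_fpstrunc ?(leq_trans (leq_subr _ _)) ?(leq_trans le_in).
Qed.

Fact fpsmulC : commutative fpsmul.
Proof. by move=> f g; apply: fpsP => n; rewrite !(fpsmulE _ _ (leqnn n)) mulrC. Qed.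

Fact fpsmulA : associative fpsmul.
Proof.
move=> f g h; apply: fpsP => n.
transitivity ((fpstrunc n f * (fpstrunc n g * fpstrunc n h))`_n).
  rewrite coefM; apply: eq_bigr => i _.
  have le_in : (i <= n)%N by rewrite -ltnS.
  by rewrite coef_fpstrunc // (fpsmulE _ _ (leq_subr i n)).
rewrite mulrA coefM; apply: eq_bigr => i _.
have le_in : (i <= n)%N by rewrite -ltnS.
by rewrite coef_fpstrunc ?leq_subr // (fpsmulE _ _ le_in).
Qed.

Fact fpsmul1 : left_id fps1 fpsmul.
Proof.
move=> f; apply: fpsP => n /=.
rewrite big_ord_recl /= mul1r subn0 big1 ?addr0 // => i _.
by rewrite mul0r.
Qed.

Fact fpsmulDl : left_distributive fpsmul (@fpsadd R).
Proof.
move=> f g h; apply: fpsP => n /=; rewrite -big_split /=.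
by apply: eq_bigr => i _; rewrite mulrDl.
Qed.

Fact fps1_neq0 : fps1 != 0.
Proof.
by apply/eqP => /(congr1 (fun f => fpscoef f 0)) /= /eqP; rewrite oner_eq0.
Qed.

HB.instance Definition _ := GRing.Zmodule_isComNzRing.Build (fps R)
  fpsmulA fpsmulC fpsmul1 fpsmulDl fps1_neq0.

Lemma fpscoefM f g n :
  fpscoef (f * g) n = \sum_(i < n.+1) fpscoef f i * fpscoef g (n - i).
Proof. by []. Qed.

End FpsRing.

Lemma fps_neq0P (R : zmodType) (f : fps R) : f != 0 ->
  exists2 n, fpscoef f n != 0 & forall i, (i < n)%N -> fpscoef f i = 0.
Proof.
move=> f0.
have ex : exists n, fpscoef f n != 0.
  apply: contrapT => H; move/eqP: f0; apply; apply: fpsP => n /=.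
  by apply/eqP/negPn/negP => fn; apply: H; exists n.
case: (ex_minnP ex) => n fn min_n; exists n => // i lt_in.
by apply/eqP/negPn/negP => /min_n; rewrite leqNgt lt_in.
Qed.

Lemma fps_mulf_eq0 (R : idomainType) (f g : fps R) :
  f * g = 0 -> (f == 0) || (g == 0).
Proof.
move=> fg0; apply/norP => -[/fps_neq0P[a fa mina] /fps_neq0P[b gb minb]].
have := congr1 (fun f => fpscoef f (a + b)) fg0; rewrite fpscoefM /=.
have lt_a : (a < (a + b).+1)%N by rewrite ltnS leq_addr.
rewrite (bigD1 (Ordinal lt_a)) //= addKn big1 => [|i ne_ia].
  by rewrite addr0 => /eqP; rewrite mulf_eq0 (negPf fa) (negPf gb).
have [lt_ia|] := ltnP i a; first by rewrite mina // mul0r.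
rewrite leq_eqVlt eq_sym => /orP[/eqP e|lt_ai].
  by case/eqP: ne_ia; apply: val_inj.
by rewrite minb ?mulr0 //; have := ltn_ord i; lia.
Qed.

Definition ell (m : nat) : nat := (2 * m).+1.

(* [i]: the coefficient of x^N in \sum x^(n^2), over the integers n = i mod l,
   is the number of such n with n^2 = N; these lie in [-N, N], which
   t |-> t - N enumerates. *)
Definition brak (m : nat) (i : int) : fps 'F_2 :=
  Fps (fun N => \sum_(t < (2 * N).+1 |
    ((t%:Z - N%:Z == i %[mod (ell m)%:Z])%Z) && ((t%:Z - N%:Z) ^+ 2 == N%:Z)) 1).

(* Since 2 = 0, a subring is the same as a Z/2-subalgebra. *)
Definition inS (m : nat) : {pred fps 'F_2} := fun f =>
  `[< forall A : {pred fps 'F_2}, subring_closed A ->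
      (forall k, (1 <= k <= m)%N -> brak m k%:Z \in A) -> f \in A >].

Lemma inSP m (f : fps 'F_2) : reflect
  (forall A : {pred fps 'F_2}, subring_closed A ->
     (forall k, (1 <= k <= m)%N -> brak m k%:Z \in A) -> f \in A)
  (f \in inS m).
Proof. exact: asboolP. Qed.

Fact inS_subring m : subring_closed (inS m).
Proof.
split=> [|f g /inSP Sf /inSP Sg|f g /inSP Sf /inSP Sg];
  apply/inSP => A rA genA; have [A1 AB AM] := rA.
- exact: A1.
- by apply: AB; [apply: Sf | apply: Sg].
- by apply: AM; [apply: Sf | apply: Sg].
Qed.

Lemma brak_inS m k : (1 <= k <= m)%N -> brak m k%:Z \in inS m.
Proof. by move=> k_m; apply/inSP => A _; apply. Qed.

Record Sring (m : nat) := MkS { Sval :> fps 'F_2; _ : Sval \in inS m }.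

HB.instance Definition _ m := [isSub for @Sval m].
HB.instance Definition _ m := [Choice of Sring m by <:].
HB.instance Definition _ m :=
  GRing.SubChoice_isSubComNzRing.Build _ (inS m) (Sring m) (inS_subring m).

Section Sdomain.
Variable m : nat.
Implicit Types x y : Sring m.

Definition Sunit : {pred Sring m} := fun x => `[< exists y, y * x == 1 >].

Definition Sinv x : Sring m :=
  if pselect (exists y, y * x == 1) is left ex then xchoose ex else x.

Fact SmulVx : {in Sunit, left_inverse 1 Sinv *%R}.
Proof.
move=> x /asboolP ux; rewrite /Sinv; case: pselect => // ex.
by apply/eqP; exact: (xchooseP ex).
Qed.

Fact SunitPl x y : y * x = 1 -> Sunit x.
Proof. by move=> yx; apply/asboolP; exists y; rewrite yx. Qed.

Fact Sinv_out : {in [predC Sunit], Sinv =1 id}.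
Proof.
move=> x /negP nux; rewrite /Sinv; case: pselect => // ex.
by case: nux; apply/asboolP.
Qed.

HB.instance Definition _ :=
  GRing.ComNzRing_hasMulInverse.Build (Sring m) SmulVx SunitPl Sinv_out.

Fact Smulf_eq0 : GRing.integral_domain_axiom (Sring m).
Proof.
move=> x y xy0; have := congr1 (@Sval m) xy0.
by rewrite -!(inj_eq val_inj) => /fps_mulf_eq0.
Qed.

HB.instance Definition _ :=
  GRing.ComUnitRing_isIntegral.Build (Sring m) Smulf_eq0.

Lemma natr2_Sring : (2%:R : Sring m) = 0.
Proof.
apply: val_inj; apply: fpsP => n.
rewrite [LHS](_ : _ = (n == 0)%N%:R + (n == 0)%N%:R) ?rmorphMn //.
by case: (n == 0)%N; apply: val_inj.
Qed.

End Sdomain.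

Lemma brakD m (i j : int) : (i == j %[mod (ell m)%:Z])%Z -> brak m i = brak m j.
Proof.
move=> /eqP eij; apply: fpsP => N /=; apply: eq_bigl => t.
by rewrite eij.
Qed.

Lemma brakN m (i : int) : brak m (- i) = brak m i.
Proof.
apply: fpsP => N /=.
rewrite (reindex_inj rev_ord_inj) /=; apply: eq_bigl => t.
have -> : ((2 * N).+1 - t.+1)%N%:Z - N%:Z = - (t%:Z - N%:Z).
  have := ltn_ord t; lia.
rewrite sqrrN; congr (_ && _).
by rewrite !eqz_mod_dvd -opprD rpredN.
Qed.

(* Multiplication by r permutes the nonzero residues mod l, and [-i] = [i]. *)
Lemma brak_coprime_inS m (r : int) (k : 'I_m) :
  coprimez r (ell m)%:Z -> brak m (r * k.+1%:Z) \in inS m.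
Proof.
move=> co_r.
set l := ell m; set a := `|((r * k.+1%:Z) %% l%:Z)%Z|%N.
have l_gt0 : (0 < l)%N by [].
have ea : a%:Z = ((r * k.+1%:Z) %% l%:Z)%Z by rewrite gez0_abs ?modz_ge0.
have lt_al : (a < l)%N by rewrite -ltz_nat ea ltz_pmod.
have a_gt0 : (0 < a)%N.
  rewrite lt0n; apply/eqP => a0; move: ea; rewrite a0 => /esym/dvdz_mod0P.
  rewrite Gauss_dvdzr 1?coprimez_sym //.
  move=> dv; have := dvdn_leq (ltn0Sn k) dv; have := ltn_ord k.
  rewrite /l /ell; lia.
have -> : brak m (r * k.+1%:Z) = brak m a%:Z.
  by apply: brakD; rewrite ea modz_mod.
have [le_am|lt_ma] := leqP a m; first by apply: brak_inS; rewrite a_gt0.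
have -> : brak m a%:Z = brak m (l - a)%N%:Z.
  rewrite -brakN; apply: brakD; rewrite eqz_mod_dvd.
  have -> : - a%:Z - (l - a)%N%:Z = - l%:Z by lia.
  by rewrite rpredN.
by apply: brak_inS; move: lt_al lt_ma; rewrite /l /ell; lia.
Qed.

Section Phi.
Variables (m : nat) (r : int) (co_r : coprimez r (ell m)%:Z).

Definition phi_gen (k : 'I_m) : Sring m := MkS (brak_coprime_inS k co_r).

Definition F2S (c : 'F_2) : Sring m := (c : nat)%:R.

Fact F2S_zmod : zmod_morphism F2S.
Proof.
move=> [[|[|?]] ?] [[|[|?]] ?] //=; rewrite /F2S /= ?subrr ?subr0 ?sub0r //.
by apply/eqP; rewrite -addr_eq0 -[_ + _]/(2%:R) natr2_Sring.
Qed.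

Fact F2S_monoid : monoid_morphism F2S.
Proof.
by split=> // -[[|[|?]] ?] [[|[|?]] ?] //=; rewrite /F2S /= ?mul0r ?mulr0 ?mulr1.
Qed.

HB.instance Definition _ := GRing.isZmodMorphism.Build 'F_2 (Sring m) F2S F2S_zmod.
HB.instance Definition _ := GRing.isMonoidMorphism.Build 'F_2 (Sring m) F2S F2S_monoid.

(* The variables x_1, ..., x_m are 'X_0, ..., 'X_(m-1). *)
Definition phi (p : {mpoly 'F_2[m]}) : Sring m := mmap F2S phi_gen p.

HB.instance Definition _ := GRing.RMorphism.copy phi (mmap F2S phi_gen).

Lemma phiX (k : 'I_m) : Sval (phi 'X_k) = brak m (r * k.+1%:Z).
Proof. by rewrite /phi mmapX mmap1U. Qed.
End Phi.

Definition ideal_gen (R : comNzRingType) (A : R -> Prop) (p : R) : Prop :=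
  exists s : seq (R * R),
    (forall c, c \in s -> A c.2) /\ p = \sum_(c <- s) c.1 * c.2.

(* x_k, where x_{l-k} = x_k; only used for 1 <= k <= 2m. *)
Definition xvar (m k : nat) : {mpoly 'F_2[m]} :=
  if insub (minn k (ell m - k)).-1 is Some i then 'X_i else 0.

Definition Rpoly (m i j : nat) : {mpoly 'F_2[m]} :=
  xvar m i ^+ 4 * xvar m (2 * j) + xvar m j ^+ 4 * xvar m (2 * i)
  + xvar m (2 * i) * xvar m (2 * j) + xvar m (i + j) ^+ 2 * xvar m (i - j) ^+ 2.

Definition Nideal (m : nat) : {mpoly 'F_2[m]} -> Prop :=
  ideal_gen (fun p => exists i j : nat,
    [/\ (1 <= j)%N, (j < i)%N, (i <= m)%N & p = Rpoly m i j]).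

(* Main.v *)
(* If u = n + a v with n in N, then phi_r(u) = phi_r(a) phi_r(v), because phi_r
   kills every R_{i,j}. The latter is a theta identity mod 2, proved by counting
   representations of each exponent as a sum of two squares. *)
Require Import Defs.
From mathcomp Require Import all_boot all_order all_algebra fraction mpoly.
From mathcomp Require Import zify ring.
Import GRing.Theory.
Local Open Scope ring_scope.

(** * Counting by bijections in boxes of integers *)

(** The maps need to be mutually inverse only on the counted elements, so [g] may be an integer
    division by 2. *)
Lemma count_bij {T : eqType} {s : seq T} {P Q : pred T} (h g : T -> T) :
  uniq s ->
  (forall x, x \in s -> P x -> [/\ h x \in s, Q (h x) & g (h x) = x]) ->
  (forall y, y \in s -> Q y -> [/\ g y \in s, P (g y) & h (g y) = y]) ->
  count P s = count Q s.
Proof.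
move=> us hP gQ; rewrite -!size_filter -(size_map h); apply: perm_size.
apply: uniq_perm; rewrite ?filter_uniq // ?map_inj_in_uniq ?filter_uniq //.
  move=> x y; rewrite !mem_filter => /andP[Px xs] /andP[Py ys] e.
  by have [_ _ <-] := hP _ xs Px; have [_ _ <-] := hP _ ys Py; rewrite e.
move=> y; rewrite mem_filter; apply/mapP/andP => [[x]|[Qy ys]].
  by rewrite mem_filter => /andP[Px xs] ->; have [] := hP _ xs Px.
have [gs Pg hg] := gQ _ ys Qy.
by exists (g y); rewrite ?mem_filter ?Pg.
Qed.

Definition int_ball (K : nat) : seq int := [seq t%:Z - K%:Z | t <- iota 0 (2 * K).+1].

Lemma mem_int_ball K a : (a \in int_ball K) = (`|a| <= K)%N.
Proof.
apply/mapP/idP => [[t]|aK]; first by rewrite mem_iota => ? ->; lia.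
by exists `|(a + K%:Z)%R|%N; rewrite ?mem_iota; lia.
Qed.

Lemma int_ball_uniq K : uniq (int_ball K).
Proof. by rewrite map_inj_uniq ?iota_uniq // => x y; lia. Qed.

Definition int_box K : seq (int * int) := [seq (a, b) | a <- int_ball K, b <- int_ball K].

Lemma mem_int_box K p : (p \in int_box K) = (`|p.1| <= K)%N && (`|p.2| <= K)%N.
Proof.
case: p => a b; rewrite -!mem_int_ball.
by apply/allpairsP/andP => [[[x y] /= [? ? [-> ->]]]|[? ?]] //; exists (a, b).
Qed.

Lemma int_box_uniq K : uniq (int_box K).
Proof. by apply: allpairs_uniq; rewrite ?int_ball_uniq // => -[? ?] []. Qed.

Lemma sum_eq_count (R : pzSemiRingType) (T : Type) (s : seq T) (P Q : pred T) :
  \sum_(x <- s | P x) (Q x)%:R = (count (predI P Q) s)%:R :> R.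
Proof.
rewrite -sum1_count natr_sum big_mkcondr /=.
by apply: eq_bigr => x _; case: (Q x).
Qed.

Lemma coef_sum_Xn_mul (R : nzRingType) K (P Q : pred int) (f g : int -> nat) n :
  ((\sum_(a <- int_ball K | P a) 'X^(f a)) *
   (\sum_(b <- int_ball K | Q b) 'X^(g b)) : {poly R})`_n =
  (count (fun p => [&& P p.1, Q p.2 & f p.1 + g p.2 == n]%N) (int_box K))%:R.
Proof.
rewrite mulr_suml coef_sum.
transitivity (\sum_(p <- int_box K | P p.1 && Q p.2) ((f p.1 + g p.2 == n)%N%:R : R)).
  rewrite [RHS]big_mkcond /int_box big_allpairs /= big_mkcond.
  apply: eq_bigr => a _; case: (P a); last by rewrite big1.
  rewrite mulr_sumr coef_sum big_mkcond /= [RHS]big_mkcond; apply: eq_bigr => b _.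
  by case: (Q b); rewrite // -exprD coefXn eq_sym.
by rewrite sum_eq_count; congr (_%:R); apply: eq_count => p /=; rewrite andbA.
Qed.

(** * Truncated theta series modulo 2 *)

Definition residue m (i : int) : pred int := fun a => (a == i %[mod (ell m)%:Z])%Z.

(** A polynomial stand-in for [[i]] with x replaced by x^e. *)
Definition theta m K e i : {poly 'F_2} :=
  \sum_(a <- int_ball K | residue m i a) 'X^(e * `|a| ^ 2).

Lemma poly_F2_addrr (p : {poly 'F_2}) : p + p = 0.
Proof. by rewrite -mulr2n -scaler_nat (_ : 2%:R = 0) ?scale0r //; apply: val_inj. Qed.

(** Squaring is additive in characteristic 2, so it acts on each monomial separately. *)
Lemma theta_sqr m K e i : theta m K e i ^+ 2 = theta m K (2 * e) i.
Proof.
rewrite /theta; apply: (big_ind2 (fun p q : {poly 'F_2} => p ^+ 2 = q)).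
- by rewrite expr0n.
- by move=> p q p' q' <- <-; rewrite sqrrD mulr2n poly_F2_addrr addr0.
- by move=> a _; rewrite -exprM; congr ('X^_); lia.
Qed.

(** Congruence modulo x^(K+1), which transfers coefficient computations from series to
    polynomials. *)
Definition fps_approx {R : comNzRingType} K (f : fps R) (p : {poly R}) :=
  forall n, (n <= K)%N -> fpscoef f n = p`_n.

Section Approx.
Variables (R : comNzRingType) (K : nat).
Implicit Types (f g : fps R) (p q : {poly R}).

Lemma fps_approxD f g p q : fps_approx K f p -> fps_approx K g q ->
  fps_approx K (f + g) (p + q).
Proof. by move=> fp gq n nK; rewrite coefD -fp // -gq. Qed.

Lemma fps_approxM f g p q : fps_approx K f p -> fps_approx K g q ->
  fps_approx K (f * g) (p * q).
Proof.
move=> fp gq n nK; rewrite fpscoefM coefM; apply: eq_bigr => i _.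
by rewrite fp ?gq //; have := ltn_ord i; lia.
Qed.

Lemma fps_approxX f p e : fps_approx K f p -> fps_approx K (f ^+ e) (p ^+ e).
Proof.
move=> fp; elim: e => [|e IH]; first by move=> n _; rewrite coef1.
by rewrite !exprS; apply: fps_approxM.
Qed.

End Approx.

(** If a^2 = n then |a| <= n <= K, so the cutoff at K loses no term of index n. *)
Lemma brak_approx m K i : fps_approx K (brak m i) (theta m K 1 i).
Proof.
move=> n nK; rewrite /theta coef_sum /=.
under [RHS]eq_bigr => a _ do rewrite coefXn mul1n.
rewrite sum_eq_count.
transitivity ((count (fun a => residue m i a && (n == `|a| ^ 2)%N) (int_ball n))%:R : 'F_2).
  rewrite /int_ball count_map -sum1_count natr_sum -(big_mkord
    (fun t => (t%:Z - n%:Z == i %[mod (ell m)%:Z])%Z && ((t%:Z - n%:Z) ^+ 2 == n%:Z)) (fun=> 1)).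
  rewrite /index_iota subn0; apply: eq_bigl => t; rewrite /residue /=; congr (_ && _).
  by apply/eqP/eqP; lia.
congr (_%:R); rewrite -!size_filter; apply: perm_size.
apply: uniq_perm; rewrite ?filter_uniq ?int_ball_uniq // => a.
rewrite !mem_filter !mem_int_ball /=; case: (residue m i a) => //=.
case: eqP => //= e; have an : (`|a| <= n)%N.
  by rewrite e -mulnn; case: `|a|%N => // k; rewrite leq_pmulr.
by rewrite an (leq_trans an nK).
Qed.

(** * Sums of two squares with prescribed residues *)

Lemma ell_coprime2 m : coprimez (ell m)%:Z 2.
Proof.
by rewrite /coprimez /gcdz /= /ell eqz_nat -/(coprime _ _) coprimen2 /= mul2n odd_double.
Qed.

Lemma residue_double m i a : residue m (2 * i) (2 * a) = residue m i a.
Proof. by rewrite /residue !eqz_mod_dvd -mulrBr Gauss_dvdzr ?ell_coprime2. Qed.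

Lemma residueD m i j a b : residue m i a -> residue m j b -> residue m (i + j) (a + b).
Proof. by rewrite /residue !eqz_mod_dvd => ia jb; rewrite opprD addrACA rpredD. Qed.

Lemma residueN m i a : residue m (- i) (- a) = residue m i a.
Proof. by rewrite /residue !eqz_mod_dvd -opprD rpredN. Qed.

Lemma coef_theta_mul m K e f i j n :
  (theta m K e i * theta m K f j)`_n =
  (count (fun p => [&& residue m i p.1, residue m j p.2
     & e * `|p.1| ^ 2 + f * `|p.2| ^ 2 == n]%N) (int_box K))%:R.
Proof. exact: coef_sum_Xn_mul. Qed.

(** The common set of pairs in which all four terms of the relation are counted. *)
Definition sum2sq_sol m (i j : int) n (p : int * int) :=
  [&& residue m (2 * i) p.1, residue m (2 * j) p.2 & `|p.1| ^ 2 + `|p.2| ^ 2 == n]%N.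

Definition evenz (a : int) := ~~ odd `|a|%N.

(** Since 4a^2 = (2a)^2, the map (a, b) -> (2a, b) is a bijection onto the solutions with even first
    entry. *)
Lemma count_even_fst m i j n :
  count (fun p => [&& residue m i p.1, residue m (2 * j) p.2
     & 4 * `|p.1| ^ 2 + 1 * `|p.2| ^ 2 == n]%N) (int_box n) =
  count (fun p => sum2sq_sol m i j n p && evenz p.1) (int_box n).
Proof.
apply: (count_bij (fun p => (2 * p.1, p.2)) (fun p => ((p.1 %/ 2)%Z, p.2))).
- exact: int_box_uniq.
- move=> [a b]; rewrite !mem_int_box /sum2sq_sol /evenz /= residue_double.
  move=> _ /and3P[-> -> /eqP e]; split => //.
  (* The equation 4a^2 + b^2 = n bounds |2a| and |b| by n. *)
  + nia.
  + by rewrite /=; apply/andP; split; [apply/eqP|]; lia.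
  + by congr pair; lia.
- move=> [a b]; rewrite !mem_int_box /sum2sq_sol /evenz /=.
  move=> ? /andP[/and3P[ra rb /eqP e] ea].
  have ha : a = 2 * (a %/ 2)%Z by lia.
  rewrite {1}ha residue_double in ra.
  split; rewrite -?ha ?ra ?rb //=; lia.
Qed.

(** This is the previous count with i and j exchanged, followed by a swap of coordinates. *)
Lemma count_even_snd m i j n :
  count (fun p => [&& residue m j p.1, residue m (2 * i) p.2
     & 4 * `|p.1| ^ 2 + 1 * `|p.2| ^ 2 == n]%N) (int_box n) =
  count (fun p => sum2sq_sol m i j n p && evenz p.2) (int_box n).
Proof.
rewrite count_even_fst.
apply: (count_bij (fun p => (p.2, p.1)) (fun p => (p.2, p.1)));
  first exact: int_box_uniq.
all: move=> [a b]; rewrite !mem_int_box /sum2sq_sol /= => /andP[-> ->].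
all: by move=> /andP[/and3P[-> -> /eqP <-] ->]; rewrite addnC eqxx.
Qed.

(** From (c + d)^2 + (c - d)^2 = 2c^2 + 2d^2, the map (c, d) -> (c + d, c - d) is a bijection onto
    the solutions whose entries have equal parity. *)
Lemma count_even_sum m (i j : int) n :
  count (fun p => [&& residue m (i + j) p.1, residue m (i - j) p.2
     & 2 * `|p.1| ^ 2 + 2 * `|p.2| ^ 2 == n]%N) (int_box n) =
  count (fun p => sum2sq_sol m i j n p && evenz (p.1 + p.2)) (int_box n).
Proof.
apply: (count_bij (fun p => (p.1 + p.2, p.1 - p.2))
  (fun p => (((p.1 + p.2) %/ 2)%Z, ((p.1 - p.2) %/ 2)%Z))).
- exact: int_box_uniq.
- move=> [c d]; rewrite !mem_int_box /sum2sq_sol /evenz /=.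
  move=> _ /and3P[rc rd /eqP e].
  have -> : 2 * i = (i + j) + (i - j) by ring.
  have -> : 2 * j = (i + j) + - (i - j) by ring.
  rewrite !residueD ?residueN //=; split.
  + nia.
  + by apply/andP; split; [apply/eqP|]; lia.
  + by congr pair; lia.
- move=> [a b]; rewrite !mem_int_box /sum2sq_sol /evenz /=.
  move=> bd /andP[/and3P[ra rb /eqP e] ea].
  have hc : 2 * ((a + b) %/ 2)%Z = a + b by lia.
  have hd : 2 * ((a - b) %/ 2)%Z = a - b by lia.
  (* The residue of a half is read off from its double, as 2 is invertible mod l. *)
  have rc : residue m (i + j) ((a + b) %/ 2)%Z.
    by rewrite -residue_double hc mulrDr residueD.
  have rd : residue m (i - j) ((a - b) %/ 2)%Z.
    by rewrite -residue_double hd mulrBr residueD // residueN.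
  rewrite rc rd; move: ((a + b) %/ 2)%Z ((a - b) %/ 2)%Z hc hd {rc rd} => c d hc hd.
  have [ha hb] : a = c + d /\ b = c - d by lia.
  rewrite {}ha {}hb in bd e *.
  split=> //; first by clear -bd; lia.
  by apply/eqP; clear -e; lia.
Qed.

(* Write both factors of each product as sums over A = 2i and B = 2j mod l of
   x^(A^2 + B^2), using [k]^2 = sum x^(2n^2) and that 2 is invertible mod l: the
   four terms collect the pairs with A even, with B even, all pairs, and those
   with A + B even. Every pair is counted an even number of times. *)
Lemma brak_identity m (i j : int) :
  brak m i ^+ 4 * brak m (2 * j) + brak m j ^+ 4 * brak m (2 * i)
  + brak m (2 * i) * brak m (2 * j)
  + brak m (i + j) ^+ 2 * brak m (i - j) ^+ 2 = 0.
Proof.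
apply: fpsP => n.
set f := (X in fpscoef X n).
(* Only the coefficient of index n is compared, so truncation at n suffices. *)
pose t := theta m n 1.
have : fps_approx n f (t i ^+ 4 * t (2 * j) + t j ^+ 4 * t (2 * i)
    + t (2 * i) * t (2 * j) + t (i + j) ^+ 2 * t (i - j) ^+ 2).
  by do ![apply: fps_approxD | apply: fps_approxM | apply: fps_approxX
         | apply: brak_approx].
move=> -> //; rewrite {}/f {}/t.
rewrite !(exprM _ 2 2) !theta_sqr !coefD !coef_theta_mul.
rewrite count_even_fst count_even_snd count_even_sum -!natrD.
rewrite [X in (_ + X + _)%N](_ : _ = count (sum2sq_sol m i j n) (int_box n)); last first.
  by apply: eq_count => p; rewrite /= !mul1n.
set N := (X in X%:R); suff : ~~ odd N.
  rewrite -dvdn2 => /dvdnP[k ->].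
  by rewrite natrM (_ : 2%:R = 0) ?mulr0 //; apply: val_inj.
(* A solution contributes 4 when both entries are even and 2 otherwise. *)
rewrite {}/N; elim: (int_box n) => //= p s; rewrite /evenz.
case: (sum2sq_sol m i j n p) => /=; lia.
Qed.

(** * Images under [phi] *)

(** For k > m the variable is x_{l-k}; since -r(l - k) = rk mod l, the symmetry [brakN] gives back
    [[rk]]. *)
Lemma phi_xvar m r (r_l : coprimez r (ell m)%:Z) k : (0 < k < ell m)%N ->
  Sval (phi r_l (xvar m k)) = brak m (r * k%:Z).
Proof.
(* The bounds on k put min(k, l - k) between 1 and m, so the default 0 of [xvar] never occurs. *)
rewrite /xvar /ell => k_ell; case: insubP => [x _ xE|]; last by lia.
rewrite phiX.
have [km|mk] := leqP k m.
  by congr (brak m (r * _)); move: xE => /= ->; lia.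
rewrite -brakN; apply: brakD; rewrite eqz_mod_dvd.
have -> : x.+1%:Z = (ell m)%:Z - k%:Z by move: xE => /= ->; rewrite /ell; lia.
have -> : - (r * ((ell m)%:Z - k%:Z)) - r * k%:Z = - r * (ell m)%:Z by ring.
exact: dvdz_mull.
Qed.

Lemma phi_Nideal m r (r_l : coprimez r (ell m)%:Z) p :
  Nideal p -> phi r_l p = 0.
Proof.
case=> s [sN ->]; rewrite rmorph_sum big_seq big1 // => c /sN[i [j [j1 ji im ->]]].
rewrite rmorphM [X in _ * X](_ : _ = 0) ?mulr0 //; apply: val_inj.
(* All indices i, j, 2i, 2j, i + j, i - j lie strictly between 0 and l. *)
rewrite /Rpoly !(rmorphD, rmorphM, rmorphXn) /= !phi_xvar; try by rewrite /ell; lia.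
have := brak_identity m (r * i%:Z) (r * j%:Z).
by rewrite -mulrDr -mulrBr PoszD -subzn 1?ltnW // !PoszM !(mulrCA 2 r).
Qed.

Theorem theorem3p9 (m : nat) (m_gt0 : (0 < m)%N) (r : int)
    (r_l : coprimez r (ell m)%:Z) (u v : {mpoly 'F_2[m]})
    (N_uv : forall p : {mpoly 'F_2[m]},
       ideal_gen (fun q => Nideal q \/ q = v) p <->
       ideal_gen (fun q => [\/ Nideal q, q = u | q = v]) p)
    (phi_v : phi r_l v != 0) :
  exists s : Sring m,
    FracField.tofrac (phi r_l u) / FracField.tofrac (phi r_l v)
      = FracField.tofrac s :> {fraction Sring m}.
Proof.
(* As a generator, u lies in (N, u, v), hence in (N, v). *)
have [s [sNv u_s]] : ideal_gen (fun q => Nideal q \/ q = v) u.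
  apply/N_uv; exists [:: (1, u)]; rewrite big_seq1 mul1r; split=> // c.
  by rewrite inE => /eqP ->; constructor 2.
(* Multiples of phi_r(v) are closed under sums, so each term of the combination is treated alone. *)
have [w uE] : exists w, phi r_l u = w * phi r_l v.
  rewrite u_s rmorph_sum big_seq.
  apply: (big_ind (fun y => exists w, y = w * phi r_l v)).
  - by exists 0; rewrite mul0r.
  - by move=> _ _ [a ->] [b ->]; exists (a + b); rewrite mulrDl.
  - move=> c /sNv[/(phi_Nideal _ _ r_l) c0|c_v]; rewrite rmorphM /=.
      by exists 0; rewrite c0 mulr0 mul0r.
    by exists (phi r_l c.1); rewrite c_v.
by exists w; rewrite uE rmorphM mulfK ?tofrac_eq0.
Qed.
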